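(* Let $\Omega\subset\mathbb R^d$ be open and bounded, and suppose that the $\frac12$-neighborhood of $\Omega$, i.e. the set of all points of $\mathbb R^d$ at Euclidean distance strictly less than $\frac12$ from $\Omega$, is connected. Then for any fixed $p\in[1,\infty)$ there is a finite constant $C$ such that $$\int_\Omega|f(x)|^p\,dx\le C\int_{\Omega\times\Omega}|f(x)-f(y)|^p\,\chi_{|x-y|<1}\,dx\,dy$$ for all measurable $f$ on $\Omega$ with $\int_\Omega f\,dx=0$. The constant $C$ does not depend on $f$.
   Context: $\chi_{|x-y|<1}$ is the indicator function of the set $\{(x,y):|x-y|<1\}$, with $|\cdot|$ the Euclidean norm. The condition $\int_\Omega f\,dx=0$ includes that $f$ is integrable on $\Omega$. *)

(* Defs.v *)
From HB Require Import structures.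
From mathcomp Require Import all_boot all_order all_algebra.
From mathcomp Require Import all_classical all_reals all_analysis.

Set Implicit Arguments.
Unset Strict Implicit.
Unset Printing Implicit Defensive.
Import Order.TTheory GRing.Theory Num.Theory.
Import numFieldNormedType.Exports.

Local Open Scope classical_set_scope.
Local Open Scope ring_scope.

(** R^d is ['rV[R]_d]; its library topology and its library
    notion of boundedness come from the sup norm, hence agree with the
    Euclidean ones. The library norm [`|x|] is the sup norm, so the Euclidean
    norm is defined separately. *)
Section euclidean.
Context {R : realType} {d : nat}.
Implicit Types (x y : 'rV[R]_d) (A : set 'rV[R]_d).

Definition enorm x : R := Num.sqrt (\sum_(i < d) x 0 i ^+ 2).

(** Extended-real-valued: the distance to the empty set is [+oo]. *)
Definition set_dist x A : \bar R :=
  ereal_inf [set (enorm (x - y))%:E | y in A].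

Definition neighborhood (r : R) A : set 'rV[R]_d :=
  [set x | (set_dist x A < r%:E)%E].

End euclidean.

(** Lebesgue outer measure: the infimum of the total volumes of the covers by
    at most countably many boxes. [None] encodes an absent box; it allows
    finite and empty covers, which matters only when d = 0, where the one
    box has volume 1. *)
Section lebesgue_outer_measure.
Context {R : realType} {d : nat}.
Local Notation box_index := (option ('rV[R]_d * 'rV[R]_d)).
Local Open Scope ereal_scope.

Definition box (ab : box_index) : set 'rV[R]_d :=
  if ab is Some (a, b) then [set x | forall i, x 0%R i \in `]a 0%R i, b 0%R i]]
  else set0.

Definition box_volume (ab : box_index) : R :=
  (if ab is Some (a, b) then \prod_(i < d) Num.max 0 (b 0 i - a 0 i) else 0)%R.

Definition lebesgue_outer (A : set 'rV[R]_d) : \bar R :=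
  ereal_inf [set \sum_(0 <= k <oo) (box_volume (B k))%:E |
    B in [set B : nat -> box_index | A `<=` \bigcup_k box (B k)]].

Lemma box_volume_ge0 ab : (0 <= box_volume ab)%R.
Proof. by case: ab => [[a b]|//]; apply: prodr_ge0 => i _; rewrite le_max lexx. Qed.

Let wge0 ab : 0 <= (box_volume ab)%:E.
Proof. by rewrite lee_fin box_volume_ge0. Qed.

Let outer_ge0 A : 0 <= lebesgue_outer A.
Proof.
by apply: le_ereal_inf_tmp => x [B _ <-]; apply: nneseries_ge0 => k _ _.
Qed.

Let outer0 : lebesgue_outer set0 = 0.
Proof.
apply/eqP; rewrite eq_le outer_ge0 andbT.
apply: ereal_inf_lbound; exists (fun=> None) => //=.
by rewrite eseries0.
Qed.

Let le_outer : {homo lebesgue_outer : A B / A `<=` B >-> A <= B}.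
Proof.
move=> A B AB; apply: ereal_inf_le_tmp => x [C BC <-].
by exists C => //; exact: subset_trans BC.
Qed.

Let outer_sigma_subadditive : sigma_subadditive lebesgue_outer.
Proof.
move=> A; have [[i ioo]|] := pselect (exists i, lebesgue_outer (A i) = +oo).
  rewrite (eseries_pinfty _ _ ioo) ?leey// => n _.
  by rewrite -ltNye (lt_le_trans _ (outer_ge0 _)).
rewrite -forallNE => Aoo.
apply/lee_addgt0Pr => e e0.
rewrite (le_trans _ (epsilon_trick _ _ (ltW e0)))//.
have e2 n : (0 < e / (2 ^ n.+1)%:R)%R by rewrite divr_gt0// ltr0n expn_gt0.
pose P n (g : nat -> box_index) := A n `<=` \bigcup_k box (g k) /\
  \sum_(0 <= k <oo) (box_volume (g k))%:E <=
    lebesgue_outer (A n) + (e / (2 ^ n.+1)%:R)%:E.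
have [G PG] : {G : nat -> nat -> box_index & forall n, P n (G n)}.
  apply: (@choice _ _ P) => n.
  have fA : lebesgue_outer (A n) \is a fin_num.
    by rewrite ge0_fin_numE// ltey; apply/eqP; exact: Aoo.
  have [x [B AB <-] lex] := lb_ereal_inf_adherent (e2 n) fA.
  by exists B; split => //; exact: ltW.
have /card_esym/ppcard_eqP[f] := card_nat2.
apply: (@le_trans _ _ (\esum_(i in setT) (box_volume (G i.1 i.2))%:E)).
  rewrite (@reindex_esum R nat (nat * nat)%type setT setT f); last first.
    by rewrite setTT_bijective.
  rewrite -nneseries_esumT//; apply: ereal_inf_lbound.
  exists (fun k => G (f k).1 (f k).2) => //= t [n _ /(PG n).1 [m _ Gt]].
  by exists (f^-1%FUN (n, m)) => //=; rewrite invK ?inE.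
have -> : [set: nat * nat] = [set: nat] `*`` (fun=> [set: nat]).
  by apply/seteqP; split.
rewrite -(@esum_esum R nat nat setT (fun=> setT)
  (fun i j => (box_volume (G i j))%:E))//.
rewrite -nneseries_esumT; last by move=> n; exact: esum_ge0.
apply: lee_nneseries => n *; first exact: esum_ge0.
by rewrite -nneseries_esumT//; exact: (PG n).2.
Qed.

HB.instance Definition _ := isOuterMeasure.Build R _ lebesgue_outer
  outer0 outer_ge0 le_outer outer_sigma_subadditive.

End lebesgue_outer_measure.

(** [measurable] on ['rV[R]_d] is Lebesgue measurability (Caratheodory's
    criterion), not merely Borel measurability. *)
HB.instance Definition _ (R : realType) (d : nat) :=
  Measurable.copy 'rV[R]_d (caratheodory_type (@lebesgue_outer R d)).

Definition lebesgue_Rd {R : realType} {d : nat} : set 'rV[R]_d -> \bar R :=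
  @lebesgue_outer R d.

HB.instance Definition _ (R : realType) (d : nat) :=
  isMeasure.Build _ _ _ (@lebesgue_Rd R d)
    (@caratheodory_measure0 _ _ (@lebesgue_outer R d))
    (@caratheodory_measure_ge0 _ _ (@lebesgue_outer R d))
    (@caratheodory_measure_sigma_additive _ _ (@lebesgue_outer R d)).

(* Main.v *)
Require Import Defs.
From HB Require Import structures.
From mathcomp Require Import all_boot all_order all_algebra.
From mathcomp Require Import all_classical all_reals all_analysis.
From mathcomp Require Import measurable_realfun ring lra.

(** Say that [S] inside [Omega x Omega] is controlled if the integral over [S]
    of [|f x - f y|^p] is at most a constant, independent of [f], times the
    right-hand side. Sets on which [|x - y| < 1] are controlled. If [U x V] and
    [V x W] are controlled and [V] has positive measure, then integrating
    [|f x - f w|^p <= 2^p (|f x - f v|^p + |f v - f w|^p)] over [v] in [V]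
    shows that [U x W] is controlled. Hence "some balls around [x] and [y] have
    a controlled product" is an equivalence relation on [Omega], and the balls
    of radius 1/2 around different classes are disjoint; connectedness leaves a
    single class. Covering [Omega] by finitely many small cells, each of which
    is controlled against a ball around one of its points, shows that
    [Omega x Omega] is controlled. Finally [f x] is the mean of [f x - f y]
    over [y], which bounds the left-hand side. *)

Set Implicit Arguments.
Unset Strict Implicit.
Unset Printing Implicit Defensive.
Import Order.TTheory GRing.Theory Num.Theory.
Import numFieldNormedType.Exports.

Local Open Scope classical_set_scope.
Local Open Scope ring_scope.

(** * Lebesgue measure on R^d *)

Section lebesgue_Rd_theory.
Context {R : realType} {d : nat}.
Implicit Types (x y c : 'rV[R]_d) (A : set 'rV[R]_d).

Lemma lebesgue_outer_cover A (B : nat -> option ('rV[R]_d * 'rV[R]_d)) :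
  A `<=` \bigcup_k box (B k) ->
  (lebesgue_outer A <= \sum_(0 <= k <oo) (box_volume (B k))%:E)%E.
Proof. by move=> AB; apply: ereal_inf_lbound; exists B. Qed.

(** The hyperplane $x_i = r$ cuts each box of a cover into [lo] and [hi], whose volumes add up to
    that of the box; if it misses the box, one half is degenerate and the truncation in [box_volume]
    gives it volume 0. Boxes are open on the left and closed on the right, which matches the split
    into $x_i \le r$ and $x_i > r$, so the halves still cover the two pieces of [X]. *)
Lemma measurable_coord_le (i : 'I_d) (r : R) :
  measurable [set x : 'rV[R]_d | x 0 i <= r].
Proof.
apply: le_caratheodory_measurable => X.
apply: le_ereal_inf_tmp => _ [B XB <-].
pose lo (ab : option ('rV[R]_d * 'rV[R]_d)) := if ab is Some (a, b) then
  Some (a, \row_j if j == i then Num.min (b 0 i) r else b 0 j) else None.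
pose hi (ab : option ('rV[R]_d * 'rV[R]_d)) := if ab is Some (a, b) then
  Some (\row_j if j == i then Num.max (a 0 i) r else a 0 j, b) else None.
have -> : (\sum_(0 <= k <oo) (box_volume (B k))%:E = \sum_(0 <= k <oo)
    ((box_volume (lo (B k)))%:E + (box_volume (hi (B k)))%:E))%E.
  apply: eq_eseriesr => k _; rewrite -EFinD; congr (_%:E).
  case: (B k) => [[a b]|] /=; last by rewrite addr0.
  rewrite (bigD1 i)//= [X in _ = X + _](bigD1 i)//=.
  rewrite [X in _ = _ + X](bigD1 i)//= !mxE eqxx.
  rewrite [X in _ = _ * X + _](eq_bigr (fun j => Num.max 0 (b 0 j - a 0 j))).
    rewrite [X in _ = _ + _ * X](eq_bigr (fun j => Num.max 0 (b 0 j - a 0 j))).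
      rewrite -mulrDl; congr (_ * _).
      rewrite !maxEle !minEle.
      by case: ifPn; case: ifPn; case: ifPn; case: ifPn; case: ifPn; lra.
    by move=> j /negPf ji; rewrite mxE ji.
  by move=> j /negPf ji; rewrite mxE ji.
rewrite nneseriesD; try by move=> k _ _; rewrite lee_fin box_volume_ge0.
apply: leeD; apply: lebesgue_outer_cover => x [Xx /= xr].
- have [k _ Bkx] := XB _ Xx; exists k => //; move: Bkx.
  case: (B k) => [[a b]|] //= H j; have := H j; rewrite !in_itv/= mxE.
  case: eqVneq => [->|//] /andP[-> xb]/=; by rewrite le_min xb.
- have [k _ Bkx] := XB _ Xx; exists k => //; move: Bkx.
  move/negP: xr; rewrite -ltNge => xr.
  case: (B k) => [[a b]|] //= H j; have := H j; rewrite !in_itv/= mxE.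
  case: eqVneq => [->|//] /andP[ax ->]/=; by rewrite gt_max ax xr.
Qed.

Lemma measurable_coord (i : 'I_d) :
  measurable_fun [set: 'rV[R]_d] (fun x : 'rV[R]_d => x 0 i).
Proof.
move=> mT; apply: (measurability _ (RGenOInfty.measurableE R)) => //.
move=> _ [_ [r ->] <-]; rewrite setTI.
suff -> : (fun x : 'rV[R]_d => x 0 i) @^-1` `]r, +oo[ = ~` [set x | x 0 i <= r].
  by apply: measurableC; exact: measurable_coord_le.
by apply/seteqP; split => x /=; rewrite in_itv/= andbT ltNge => /negP.
Qed.

Lemma lebesgue_outer_translate A (t : 'rV[R]_d) :
  (lebesgue_outer [set x | A (x - t)%R] <= lebesgue_outer A)%E.
Proof.
apply: le_ereal_inf_tmp => _ [B XB <-].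
pose tr (ab : option ('rV[R]_d * 'rV[R]_d)) := if ab is Some (a, b) then
  Some (a + t, b + t) else None.
have -> : (\sum_(0 <= k <oo) (box_volume (B k))%:E = \sum_(0 <= k <oo)
    (box_volume (tr (B k)))%:E)%E.
  apply: eq_eseriesr => k _; congr (_%:E).
  case: (B k) => [[a b]|] //=; apply: eq_bigr => j _; rewrite !mxE.
  by congr (Num.max _ _); lra.
apply: lebesgue_outer_cover => x /= /XB[k _ Bkx]; exists k => //; move: Bkx.
case: (B k) => [[a b]|] //= H j; have := H j; rewrite !in_itv/= !mxE.
by rewrite ltrBrDr lerBlDr.
Qed.

Definition cube (M : R) : set 'rV[R]_d := [set x | forall i, `|x 0 i| <= M].

Lemma cube_finite (M : R) : (lebesgue_outer (cube M) < +oo)%E.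
Proof.
(* Boxes are open on the left, hence the lower corner [- M - 1] instead of [- M]. *)
pose ab := Some (const_mx (- M - 1) : 'rV[R]_d, const_mx M : 'rV[R]_d).
apply: (@le_lt_trans _ _ (\sum_(0 <= k <oo)
   (box_volume (if k == 0%N then ab else None))%:E)%E).
  apply: lebesgue_outer_cover => x xM; exists 0%N => //= i.
  by have := xM i; rewrite in_itv/= !mxE ler_norml; lra.
rewrite (nneseries_split 0 1); last first.
  by move=> k _; rewrite lee_fin box_volume_ge0.
by rewrite big_nat1 eseries0 ?adde0 ?ltry// => -[].
Qed.

Lemma measurable_coordwise (P : 'I_d -> set R) :
  (forall i, measurable (P i)) ->
  measurable [set x : 'rV[R]_d | forall i, P i (x 0 i)].
Proof.
move=> mP.
have -> : [set x : 'rV[R]_d | forall i, P i (x 0 i)] =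
    \bigcap_(i in [set: 'I_d]) (setT `&` (fun x : 'rV[R]_d => x 0 i) @^-1` P i).
  by apply/seteqP; split => [x Px i _|x Px i]; [split|case: (Px i)].
apply: fin_bigcap_measurable; first exact: finite_finset.
by move=> i _; apply: measurable_coord.
Qed.

Lemma measurable_cube M : measurable (cube M).
Proof.
apply: (@measurable_coordwise (fun=> [set r | `|r| <= M])) => i.
have -> : [set r : R | `|r| <= M] = `[- M, M]%classic.
  by apply/seteqP; split => r /=; rewrite in_itv/= ler_norml.
exact: measurable_itv.
Qed.

(** Membership in a ball includes [0 < e]; when [d = 0] the coordinates alone would not give it. *)
Lemma ball_rVE x (e : R) : 0 < e ->
  ball x e = [set y : 'rV[R]_d | forall i, `|x 0 i - y 0 i| < e].
Proof.
move=> e0; apply/seteqP; split => [y [_ xy] i|y xy]; first exact: xy.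
by split => // i j; rewrite (ord1 i); exact: xy.
Qed.

Lemma measurable_ball_rV x (e : R) : measurable (ball x e).
Proof.
have [e0|e0] := ltP 0 e; last first.
  rewrite (_ : ball x e = set0)//; apply/seteqP; split => // y [].
  by rewrite ltNge e0.
rewrite ball_rVE//; apply: (@measurable_coordwise (fun i => ball (x 0 i) e)) => i.
exact: measurable_ball.
Qed.

Lemma bounded_cube A : bounded_set A -> exists M, A `<=` cube M.
Proof.
move=> [M [Mreal AM]]; exists (M + 2) => x Ax i.
have xM : `|x| <= M + 1 by apply: AM => //; rewrite ltrDl.
have : ball 0 (M + 2) x.
  by rewrite mx_norm_ball /ball_/= sub0r normrN (le_lt_trans xM)// ltrD2l ltr1n.
by move=> [_ /(_ 0 i)]; rewrite /ball/= !mxE sub0r normrN => /ltW.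
Qed.

Lemma sigma_finite_lebesgue_Rd : sigma_finite [set: 'rV[R]_d] (@lebesgue_Rd R d).
Proof.
exists (fun n => cube n%:R).
  apply/esym/seteqP; split => // x _.
  have [M xM] : exists M, [set x] `<=` cube M.
    exists (\sum_i `|x 0 i|) => _ -> i; rewrite (bigD1 i)//= lerDl.
    by apply: sumr_ge0.
  exists (Num.truncn M).+1 => // i; apply: (le_trans (xM _ erefl i)).
  by rewrite ltW// truncnS_gt.
by move=> n; split; [exact: measurable_cube|exact: cube_finite].
Qed.

(** The centers form a grid of step [h] that starts at the corner [- M]. In coordinate $i$, the grid
    point just below [x] has as index the integer part of $(x_i + M)/h$, which is at most [N] on the
    cube. *)
Lemma cube_cover (M h : R) : 0 < h -> exists (K : finType) (c : K -> 'rV[R]_d),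
  cube M `<=` [set x | exists k, ball (c k) h x].
Proof.
move=> h0; pose N := Num.truncn ((M + M) / h).
exists {ffun 'I_d -> 'I_N.+1}.
exists (fun k : {ffun 'I_d -> 'I_N.+1} => \row_i ((k i)%:R * h - M)) => x xM.
have q (i : 'I_d) : (Num.truncn ((x 0 i + M)%R / h)%R < N.+1)%N.
  rewrite ltnS; apply: le_truncn; rewrite ler_pM2r ?invr_gt0// lerD2r.
  by have := xM i; rewrite ler_norml => /andP[].
exists [ffun i => Ordinal (q i)]; rewrite ball_rVE// => i; rewrite mxE ffunE/=.
have : 0 <= (x 0 i + M) / h.
  rewrite divr_ge0 ?(ltW h0)//; have := xM i.
  by rewrite ler_norml => /andP[]; rewrite -subr_ge0 opprK.
move=> /truncn_itv; set t := Num.truncn _ => /andP[].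
rewrite ler_pdivlMr// ltr_pdivrMr// -natr1 mulrDl mul1r => t1 t2.
by rewrite ltr_norml; lra.
Qed.

Lemma lebesgue_outer_ball (x y : 'rV[R]_d) (e : R) :
  (lebesgue_outer (ball y e) <= lebesgue_outer (ball x e))%E.
Proof.
rewrite (_ : ball y e = [set z | ball x e (z - (y - x))]).
  exact: lebesgue_outer_translate.
rewrite !mx_norm_ball; apply/seteqP; split => z /=;
  by rewrite (_ : x - (z - (y - x)) = y - z)// opprB addrA subrKC.
Qed.

(** A null neighborhood contains a null ball. By translation all balls of that radius are null, and
    finitely many of them cover a bounded set. *)
Lemma null_nbhs A x (U : set 'rV[R]_d) : bounded_set A -> nbhs x U ->
  lebesgue_outer U = 0%E -> lebesgue_outer A = 0%E.
Proof.
move=> /bounded_cube[M AM] /nbhs_ballP[e /= e0 xeU] U0.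
have ball0 y : lebesgue_outer (ball y e) = 0%E.
  apply/eqP; rewrite eq_le outer_measure_ge0 andbT -U0.
  by rewrite (le_trans (lebesgue_outer_ball x y e))// le_outer_measure.
have [K [c cK]] := cube_cover M e0.
apply/eqP; rewrite eq_le outer_measure_ge0 andbT.
have : A `<=` \big[setU/set0]_(k : K) ball (c k) e.
  move=> z /AM/cK[k kz]; rewrite -bigcup_seq; exists k => //=.
  by rewrite mem_index_enum.
move=> /(@le_outer_measure _ _ lebesgue_outer)/le_trans; apply.
elim: (index_enum K) => [|k s ih]; first by rewrite big_nil outer_measure0.
rewrite big_cons (le_trans (outer_measureU2 _ _ _))//.
rewrite -[leRHS]adde0; apply: leeD => //.
by have := lexx (lebesgue_outer (ball (c k) e)); rewrite {2}ball0.
Qed.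

End lebesgue_Rd_theory.

HB.instance Definition _ (R : realType) (d : nat) :=
  Measure_isSigmaFinite.Build _ _ _ (@lebesgue_Rd R d) sigma_finite_lebesgue_Rd.

(** * Integrals of powers of differences *)

Section powR_inequalities.
Context {R : realType}.
Implicit Types p a b s t : R.

(** The sum is at most twice the larger term, so monotonicity of the power suffices. *)
Lemma powRD_le p a b : 0 <= p -> 0 <= a -> 0 <= b ->
  (a + b) `^ p <= 2 `^ p * (a `^ p + b `^ p).
Proof.
move=> p0 a0 b0; wlog ab : a b a0 b0 / a <= b => [H|].
  have [|/ltW ba] := leP a b; first exact: H.
  by rewrite addrC [X in _ * X]addrC; apply: H.
apply: (@le_trans _ _ ((2 * b) `^ p)).
  by apply: ge0_ler_powR; rewrite ?nnegrE//; lra.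
by rewrite powRM// ler_wpM2l ?powR_ge0// lerDr powR_ge0.
Qed.

Lemma powR_dist_le p a b c : 0 <= p ->
  `|a - c| `^ p <= 2 `^ p * (`|a - b| `^ p + `|b - c| `^ p).
Proof.
move=> p0; apply: le_trans (powRD_le p0 (normr_ge0 _) (normr_ge0 _)).
by apply: ge0_ler_powR; rewrite ?nnegrE// ?addr_ge0// ler_distD.
Qed.

(* This pointwise bound, integrated over [t = |f x - f y|] with [s = |f x|],
   replaces Jensen's inequality, at the cost of a factor [2^p]. *)
Lemma le_half_powR p s t : 1 <= p -> 0 < s -> 0 <= t ->
  t <= s / 2 + (s / 2) `^ (1 - p) * t `^ p.
Proof.
(* Up to $s/2$ the first term is enough. Beyond it, $(s/2)^{1-p} t^p = t\,(t/(s/2))^{p-1} \ge t$. *)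
move=> p1 s0 t0; have [ts|st] := leP t (s / 2).
  by rewrite (le_trans ts)// lerDl mulr_ge0 ?powR_ge0.
apply: (@le_trans _ _ ((s / 2) `^ (1 - p) * t `^ p)); last first.
  by rewrite lerDr; lra.
have s2 : 0 < s / 2 by lra.
have -> : 1 - p = - (p - 1) by lra.
rewrite powRN ler_pdivlMl ?powR_gt0// -[leRHS]mulr_powRB1 ?(lt_trans s2 st)//; last by lra.
rewrite mulrC ler_wpM2l// ge0_ler_powR ?nnegrE//; [lra|exact: ltW|exact: ltW].
Qed.

End powR_inequalities.

(** * Tonelli's theorem on measurable rectangles *)

Section tonelli_rectangle.
Local Open Scope ereal_scope.
Context d1 d2 (T1 : measurableType d1) (T2 : measurableType d2) (R : realType).
Variables (m1 : {sigma_finite_measure set T1 -> \bar R})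
  (m2 : {sigma_finite_measure set T2 -> \bar R}).
Variables (A : set T1) (B : set T2) (mA : measurable A) (mB : measurable B).
Variables (h : T1 * T2 -> \bar R) (mh : measurable_fun setT h)
  (h0 : forall z, 0 <= h z).

(** Tonelli's theorem on the whole product is applied to the extension of [h] by zero outside the
    rectangle. *)
Let hAB : measurable_fun setT (h \_ (A `*` B)).
Proof. by apply/(measurable_restrictT _ _).1; [exact: measurableX|exact: measurable_funTS]. Qed.

Let hAB0 z : 0 <= (h \_ (A `*` B)) z.
Proof. by rewrite patchE; case: ifPn. Qed.

Lemma tonelli_rectangle1 :
  \int[m1 \x m2]_(z in A `*` B) h z = \int[m1]_(x in A) \int[m2]_(y in B) h (x, y).
Proof.
rewrite integral_mkcond (fubini_tonelli1 _ hAB hAB0) [RHS]integral_mkcond.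
apply: eq_integral => x _; rewrite /fubini_F [RHS]patchE.
case: ifPn => xA.
  rewrite [RHS]integral_mkcond; apply: eq_integral => y _.
  by rewrite !patchE in_setX/= xA.
by rewrite integral0_eq// => y _; rewrite patchE in_setX/= (negbTE xA).
Qed.

Lemma tonelli_rectangle2 :
  \int[m1 \x m2]_(z in A `*` B) h z = \int[m2]_(y in B) \int[m1]_(x in A) h (x, y).
Proof.
rewrite integral_mkcond (fubini_tonelli2 _ hAB hAB0) [RHS]integral_mkcond.
apply: eq_integral => y _; rewrite /fubini_G [RHS]patchE.
case: ifPn => yB.
  rewrite [RHS]integral_mkcond; apply: eq_integral => x _.
  by rewrite !patchE in_setX/= yB andbT.
by rewrite integral0_eq// => x _; rewrite patchE in_setX/= (negbTE yB) andbF.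
Qed.

Lemma measurable_integral_fst : measurable_fun setT (fun y => \int[m1]_(x in A) h (x, y)).
Proof.
rewrite [X in measurable_fun _ X](_ : _ = fubini_G m1 (h \_ (A `*` setT))).
  apply: measurable_fun_fubini_tonelli_G => //.
    by apply/(measurable_restrictT _ _).1; [exact: measurableX|exact: measurable_funTS].
  by move=> z; rewrite patchE; case: ifPn.
apply/funext => y; rewrite /fubini_G [LHS]integral_mkcond.
by apply: eq_integral => x _; rewrite !patchE in_setX/= in_setT andbT.
Qed.

Lemma measurable_integral_snd : measurable_fun setT (fun x => \int[m2]_(y in B) h (x, y)).
Proof.
rewrite [X in measurable_fun _ X](_ : _ = fubini_F m2 (h \_ (setT `*` B))).
  apply: measurable_fun_fubini_tonelli_F => //.
    by apply/(measurable_restrictT _ _).1; [exact: measurableX|exact: measurable_funTS].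
  by move=> z; rewrite patchE; case: ifPn.
apply/funext => x; rewrite /fubini_F [LHS]integral_mkcond.
by apply: eq_integral => y _; rewrite !patchE in_setX/= in_setT.
Qed.

End tonelli_rectangle.

Section cylinder.
Local Open Scope ereal_scope.
Context d1 d2 (T1 : measurableType d1) (T2 : measurableType d2) (R : realType).
Variables (m1 : {sigma_finite_measure set T1 -> \bar R})
  (m2 : {sigma_finite_measure set T2 -> \bar R}).
Variables (U : set T1) (W : set T2) (mU : measurable U) (mW : measurable W).

Lemma integral_cylinder_fst (a : T1 -> \bar R) : measurable_fun setT a ->
  (forall x, 0 <= a x) ->
  \int[m1 \x m2]_(z in U `*` W) a z.1 = m2 W * \int[m1]_(x in U) a x.
Proof.
move=> ma a0.
have mafst : measurable_fun setT (fun z : T1 * T2 => a z.1).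
  exact: measurableT_comp ma measurable_fst.
rewrite (tonelli_rectangle1 _ _ mU mW mafst (fun z => a0 z.1)).
rewrite -(ge0_integralZl _ mU (measurable_funTS ma) (fun x _ => a0 x))//.
by apply: eq_integral => x _; rewrite /= (integral_cst _ mW) muleC.
Qed.

Lemma integral_cylinder_snd (b : T2 -> \bar R) : measurable_fun setT b ->
  (forall y, 0 <= b y) ->
  \int[m1 \x m2]_(z in U `*` W) b z.2 = m1 U * \int[m2]_(y in W) b y.
Proof.
move=> mb b0.
have mbsnd : measurable_fun setT (fun z : T1 * T2 => b z.2).
  exact: measurableT_comp mb measurable_snd.
rewrite (tonelli_rectangle2 _ _ mU mW mbsnd (fun z => b0 z.2)).
rewrite -(ge0_integralZl _ mW (measurable_funTS mb) (fun x _ => b0 x))//.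
by apply: eq_integral => y _; rewrite /= (integral_cst _ mU) muleC.
Qed.

End cylinder.

(** * A quasi-triangle inequality for double integrals *)

Section quasi_triangle.
Local Open Scope ereal_scope.
Context d (T : measurableType d) (R : realType).
Variables (mu : {sigma_finite_measure set T -> \bar R}).
Variables (g : T * T -> \bar R) (K : R).
Hypotheses (mg : measurable_fun setT g) (g0 : forall z, 0 <= g z)
  (K0 : (0 <= K)%R) (gK : forall x y w, g (x, w) <= K%:E * (g (x, y) + g (y, w))).
Variables U V W : set T.
Hypotheses (mU : measurable U) (mV : measurable V) (mW : measurable W).

Let A x := \int[mu]_(y in V) g (x, y).
Let B w := \int[mu]_(y in V) g (y, w).

Let mA : measurable_fun setT A. Proof. exact: measurable_integral_snd. Qed.
Let mB : measurable_fun setT B. Proof. exact: measurable_integral_fst. Qed.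
Let A0 x : 0 <= A x. Proof. exact: integral_ge0. Qed.
Let B0 w : 0 <= B w. Proof. exact: integral_ge0. Qed.

(** The hypothesis [gK] is integrated over the intermediate point [y] in [V]; its left-hand side
    does not depend on [y], which produces the factor [mu V]. *)
Let pointwise x w : mu V * g (x, w) <= K%:E * (A x + B w).
Proof.
rewrite muleC -(integral_cst _ mV).
have mgx : measurable_fun V (fun y => g (x, y)).
  apply: measurable_funTS; exact: measurableT_comp mg (pair1_measurable _).
have mgw : measurable_fun V (fun y => g (y, w)).
  apply: measurable_funTS; exact: measurableT_comp mg (pair2_measurable _).
have mD := emeasurable_funD mgx mgw.
rewrite /A /B -(ge0_integralD _ mV (fun y _ => g0 (x, y)) mgx (fun y _ => g0 (y, w)) mgw).
rewrite -(ge0_integralZl_EFin _ mV _ mD K0); last first.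
  by move=> y _; exact: adde_ge0.
apply: (ge0_le_integral _ mV).
- by move=> y _; exact: g0.
- exact: measurable_cst.
- exact: measurable_funeM.
- by move=> y _; exact: gK.
Qed.

(** Integrate [pointwise] over the rectangle of [U] and [W]. There [A] depends on the first variable
    only, so the second one contributes the factor [mu W]; symmetrically, [B] comes with [mu U]. *)
Lemma integral_quasi_triangle :
  mu V * \int[mu \x mu]_(z in U `*` W) g z <=
  K%:E * (mu W * \int[mu \x mu]_(z in U `*` V) g z +
          mu U * \int[mu \x mu]_(z in V `*` W) g z).
Proof.
have mUW : measurable (U `*` W) by exact: measurableX.
rewrite (tonelli_rectangle1 mu mu mU mV mg g0).
rewrite (tonelli_rectangle2 mu mu mV mW mg g0).
rewrite -/A -/B -(integral_cylinder_fst mu mu mU mW mA A0).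
rewrite -(integral_cylinder_snd mu mu mU mW mB B0).
have mA1 : measurable_fun (U `*` W) (fun z : T * T => A z.1).
  exact: measurable_funTS (measurableT_comp mA measurable_fst).
have mB2 : measurable_fun (U `*` W) (fun z : T * T => B z.2).
  exact: measurable_funTS (measurableT_comp mB measurable_snd).
rewrite -(ge0_integralD (mu \x mu) mUW (fun z _ => A0 z.1) mA1 (fun z _ => B0 z.2) mB2).
have mD := emeasurable_funD mA1 mB2.
rewrite -(ge0_integralZl_EFin (mu \x mu) mUW _ mD K0); last first.
  by move=> z _; apply: adde_ge0; [exact: A0|exact: B0].
have mgUW := measurable_funTS mg : measurable_fun (U `*` W) g.
rewrite -(ge0_integralZl (mu \x mu) mUW mgUW (fun z _ => g0 z) (measure_ge0 mu V)).
apply: (ge0_le_integral (mu \x mu) mUW).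
- by move=> z _; apply: mule_ge0; [exact: measure_ge0|exact: g0].
- exact: measurable_funeM.
- exact: measurable_funeM.
- by move=> [x w] _; exact: pointwise.
Qed.

End quasi_triangle.

Section dist_powR.
Local Open Scope ereal_scope.
Context d (T : measurableType d) (R : realType).
Variables (mu : {sigma_finite_measure set T -> \bar R}) (p : R) (p1 : (1 <= p)%R).
Implicit Types (f : T -> R) (U V W : set T) (S : set (T * T)).

Definition dist_powR f (z : T * T) : \bar R := (`|f z.1 - f z.2| `^ p)%:E.

Let p0 : (0 <= p)%R. Proof. by rewrite (le_trans _ p1). Qed.

Lemma dist_powR_ge0 f z : 0 <= dist_powR f z.
Proof. by rewrite lee_fin powR_ge0. Qed.

Lemma measurable_dist_powR f : measurable_fun setT f ->
  measurable_fun setT (dist_powR f).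
Proof.
move=> mf; apply/measurable_EFinP.
apply: (measurableT_comp (measurable_powR p)).
apply: measurableT_comp => //; apply: measurable_funB.
- exact: measurableT_comp mf measurable_fst.
- exact: measurableT_comp mf measurable_snd.
Qed.

Lemma integral_dist_powR_trans f U V W :
  measurable U -> measurable V -> measurable W -> measurable_fun setT f ->
  mu V * \int[mu \x mu]_(z in U `*` W) dist_powR f z <=
  (2 `^ p)%:E * (mu W * \int[mu \x mu]_(z in U `*` V) dist_powR f z +
                 mu U * \int[mu \x mu]_(z in V `*` W) dist_powR f z).
Proof.
move=> mU mV mW /measurable_dist_powR mg.
apply: (integral_quasi_triangle mu mg (dist_powR_ge0 f) (powR_ge0 _ _)) => //.
by move=> x y w; rewrite -EFinD -EFinM lee_fin powR_dist_le.
Qed.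

Let measurable_xsec f x U : measurable_fun setT f ->
  measurable_fun U (fun y => dist_powR f (x, y)).
Proof.
move=> /measurable_dist_powR mg; apply: measurable_funTS.
exact: measurableT_comp mg (pair1_measurable _).
Qed.

(** Write $s = |f(x)|$ and let $G$ be the integral on the right. As $f$ has mean zero, $m f(x)$ is
    the integral of $f(x) - f(y)$ over $y$, so [le_half_powR] gives $m s \le m s/2 + (s/2)^{1-p} G$.
    Absorbing $m s/2$ on the left and multiplying by $(s/2)^{p-1}$ yields $m (s/2)^p \le G$. *)
Let pointwise f U x (m : R) : measurable U -> mu U = m%:E -> (0 < m)%R ->
  measurable_fun setT f -> mu.-integrable U (EFin \o f) ->
  \int[mu]_(x in U) (f x)%:E = 0 ->
  m%:E * (`|f x| `^ p)%:E <= (2 `^ p)%:E * \int[mu]_(y in U) dist_powR f (x, y).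
Proof.
move=> mU muU m0 mf intf f0; set G := \int[mu]_(y in U) _.
have G0 : 0 <= G by apply: integral_ge0 => y _; exact: dist_powR_ge0.
(* The zero case is separate because [le_half_powR] needs [0 < s]; here $0^p = 0$ since $p \ne
   0$. *)
have [->|fx0] := eqVneq (f x) 0%R.
  rewrite normr0 powR0 ?mule0; last by rewrite gt_eqF// (lt_le_trans _ p1).
  by rewrite mule_ge0// lee_fin powR_ge0.
set s := `|f x|%R; have s0 : (0 < s)%R by rewrite normr_gt0.
have cstE (r : R) : \int[mu]_(y in U) r%:E = (r * m)%:E.
  by rewrite EFinM -muU -(integral_cst _ mU).
have mgx : measurable_fun U (fun y => dist_powR f (x, y)) by exact: measurable_xsec.
have mfB : measurable_fun U (fun y => (f x)%:E - (f y)%:E).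
  apply: emeasurable_funB; first exact: measurable_cst.
  by apply/measurable_EFinP; exact: measurable_funTS.
have c0 : (0 <= (s / 2) `^ (1 - p))%R by exact: powR_ge0.
have : (m * s)%:E <= (s / 2 * m)%:E + ((s / 2) `^ (1 - p))%:E * G.
  have -> : (m * s)%:E = `|\int[mu]_(y in U) ((f x)%:E - (f y)%:E)|.
    have intc : mu.-integrable U (EFin \o (cst (f x))).
      apply/integrableP; split; first exact/measurable_EFinP/measurable_cst.
      suff -> : \int[mu]_(y in U) `|(EFin \o cst (f x)) y| = (`|f x| * m)%:E.
        by rewrite ltry.
      exact: (cstE `|f x|%R).
    rewrite (integralB_EFin mU intc intf).
    rewrite f0 sube0 cstE abse_EFin normrM (gtr0_norm m0).
    by rewrite mulrC.
  apply: (le_trans (le_abse_integral _ mU mfB)).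
  rewrite -cstE -(ge0_integralZl_EFin _ mU (fun y _ => dist_powR_ge0 f (x, y)) mgx c0).
  have mcg : measurable_fun U (fun y => ((s / 2) `^ (1 - p))%:E * dist_powR f (x, y)).
    exact: measurable_funeM.
  rewrite -(ge0_integralD _ mU _ (measurable_cst _) _ mcg); first last.
  - by move=> y _; rewrite mule_ge0// dist_powR_ge0.
  - by move=> y _; rewrite lee_fin divr_ge0// ltW.
  apply: (ge0_le_integral _ mU).
  - by move=> y _; exact: abse_ge0.
  - exact: measurableT_comp.
  - exact: emeasurable_funD.
  move=> y _; rewrite /dist_powR -EFinB abse_EFin -EFinM -EFinD lee_fin.
  exact: le_half_powR.
have -> : ((s / 2) `^ (1 - p) = ((s / 2) `^ (p - 1))^-1)%R.
  by rewrite -powRN opprB.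
(* The term $m s/2$ is cancelled among real numbers, hence the case analysis on the extended real
   product. *)
move=> H; have {}H : (m * (s / 2))%:E <= (((s / 2) `^ (p - 1))^-1)%:E * G.
  move: H; case: (_ * G) => [r||]; rewrite ?leey// -EFinD !lee_fin; lra.
move: H; rewrite lee_pdivlMl ?powR_gt0//; last lra.
have -> : (s `^ p = 2 `^ p * (s / 2 * (s / 2) `^ (p - 1)))%R.
  have pgt0 : (0 < p)%R by rewrite (lt_le_trans _ p1).
  rewrite mulr_powRB1 -?powRM//; try lra.
  by congr (_ `^ _)%R; lra.
rewrite -!EFinM => H.
apply: (@le_trans _ _ ((2 `^ p)%:E * ((s / 2) `^ (p - 1) * (m * (s / 2)))%:E)).
  by rewrite -EFinM lee_fin; lra.
by rewrite lee_pmul2l// lte_fin powR_gt0.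
Qed.

Lemma integral_powR_le_dist f U (m : R) : measurable U -> mu U = m%:E -> (0 < m)%R ->
  measurable_fun setT f -> mu.-integrable U (EFin \o f) ->
  \int[mu]_(x in U) (f x)%:E = 0 ->
  m%:E * \int[mu]_(x in U) (`|f x| `^ p)%:E <=
  (2 `^ p)%:E * \int[mu \x mu]_(z in U `*` U) dist_powR f z.
Proof.
move=> mU muU m0 mf intf f0.
have mg := measurable_dist_powR mf.
have g0 := dist_powR_ge0 f.
have mfp : measurable_fun U (fun x => (`|f x| `^ p)%:E).
  apply/measurable_EFinP; apply: (measurableT_comp (measurable_powR p)).
  by apply: measurableT_comp => //; exact: measurable_funTS.
rewrite (tonelli_rectangle1 mu mu mU mU mg g0).
have mG : measurable_fun U (fun x => \int[mu]_(y in U) dist_powR f (x, y)).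
  apply: measurable_funTS; exact: measurable_integral_snd.
have G0 x : U x -> 0 <= \int[mu]_(y in U) dist_powR f (x, y).
  by move=> _; apply: integral_ge0 => y _; exact: g0.
have fp0 x : U x -> 0 <= (`|f x| `^ p)%:E by rewrite lee_fin powR_ge0.
rewrite -(ge0_integralZl_EFin _ mU fp0 mfp (ltW m0)).
rewrite -(ge0_integralZl_EFin _ mU G0 mG (powR_ge0 _ _)).
apply: (ge0_le_integral _ mU).
- by move=> x Ux; rewrite mule_ge0 ?fp0// lee_fin ltW.
- exact: measurable_funeM.
- exact: measurable_funeM.
- by move=> x _; exact: pointwise.
Qed.

(** * Closure properties of controlled sets *)

Section controlled.
Variable E : (T -> R) -> \bar R.

(** [E f] stands for the right-hand side of the inequality and is abstract here. Nonnegativity of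
    [C] lets sums of constants distribute over [E f], which may be infinite. Functions given only on
    a subset enter through their extension by zero. *)
Definition controlled S := exists2 C : R, (0 <= C)%R &
  forall f, measurable_fun setT f ->
    \int[mu \x mu]_(z in S) dist_powR f z <= C%:E * E f.

Lemma controlledS S S' : measurable S -> measurable S' -> S `<=` S' ->
  controlled S' -> controlled S.
Proof.
move=> mS mS' SS' [C C0 H]; exists C => // f mf; apply: le_trans (H f mf).
apply: (ge0_subset_integral (mu \x mu) mS mS' _ _ SS').
- exact: measurable_funTS (measurable_dist_powR mf).
- by move=> z _; exact: dist_powR_ge0.
Qed.

Lemma controlled0 : controlled set0.
Proof. by exists 0%R => // f _; rewrite integral_set0 mul0e. Qed.

Lemma controlledU S S' : measurable S -> measurable S' ->
  controlled S -> controlled S' -> controlled (S `|` S').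
Proof.
move=> mS mS' [C C0 H] [C' C'0 H']; exists (C + C')%R; first exact: addr_ge0.
move=> f mf; have mg := measurable_dist_powR mf.
rewrite EFinD ge0_muleDl//.
(* The union is made disjoint so that its integral splits. *)
have -> : S `|` S' = S `|` (S' `\` S) by rewrite setUDr setDv setD0.
have mS'S : measurable (S' `\` S) by exact: measurableD.
rewrite (ge0_integral_setU (mu \x mu) mS mS'S (measurable_funTS mg)
  (fun z _ => dist_powR_ge0 f z)).
  apply: leeD; first exact: H.
  apply: le_trans (H' f mf).
  apply: (ge0_subset_integral (mu \x mu) mS'S mS' (measurable_funTS mg)
    (fun z _ => dist_powR_ge0 f z)).
  exact: subDsetl.
by rewrite disj_set2E setDIK.
Qed.

Lemma controlled_bigsetU (I : Type) (s : seq I) (F : I -> set (T * T)) :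
  (forall i, measurable (F i)) -> (forall i, controlled (F i)) ->
  controlled (\big[setU/set0]_(i <- s) F i).
Proof.
move=> mF cF; elim: s => [|i s ih]; first by rewrite big_nil; exact: controlled0.
rewrite big_cons; apply: controlledU => //.
exact: bigsetU_measurable.
Qed.

(** Divide [integral_dist_powR_trans] by [mu V], which must be positive and finite; the measures of
    [U] and [W] enter the constant and must be finite too. *)
Lemma controlled_trans U V W : measurable U -> measurable V -> measurable W ->
  mu U < +oo -> 0 < mu V < +oo -> mu W < +oo ->
  controlled (U `*` V) -> controlled (V `*` W) -> controlled (U `*` W).
Proof.
move=> mU mV mW Uoo /andP[V0 Voo] Woo [C C0 H] [C' C'0 H'].
have finE X : mu X < +oo -> mu X = (fine (mu X))%:E.
  by move=> ?; rewrite fineK// ge0_fin_numE.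
have u0 : (0 <= fine (mu U))%R by rewrite fine_ge0.
have w0 : (0 <= fine (mu W))%R by rewrite fine_ge0.
have v0 : (0 < fine (mu V))%R by rewrite fine_gt0// V0.
exists ((fine (mu V))^-1 * (2 `^ p * (fine (mu W) * C + fine (mu U) * C')))%R.
  by rewrite !mulr_ge0 ?invr_ge0 ?powR_ge0 ?(ltW v0)// addr_ge0// mulr_ge0.
move=> f mf; rewrite EFinM -muleA lee_pdivlMl// -finE//.
apply: (le_trans (integral_dist_powR_trans mU mV mW mf)).
rewrite EFinM -muleA lee_pmul2l ?lte_fin ?powR_gt0//.
rewrite EFinD ge0_muleDl ?lee_fin ?mulr_ge0// !EFinM -!finE// -!muleA.
by apply: leeD; apply: lee_wpmul2l => //; [exact: H|exact: H'].
Qed.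

End controlled.
End dist_powR.

(** * Euclidean distance and measurability of open sets *)

Section euclidean_norm.
Context {R : realType} {d : nat}.
Implicit Types x y z : 'rV[R]_d.

Lemma enorm_lt x (r : R) : 0 < r -> (enorm x < r) = (\sum_i x 0 i ^+ 2 < r ^+ 2).
Proof.
move=> r0; rewrite /enorm -[X in _ < X](gtr0_norm r0) -sqrtr_sqr.
by rewrite ltr_sqrt// exprn_gt0.
Qed.

Lemma enormC x y : enorm (x - y) = enorm (y - x).
Proof.
by congr Num.sqrt; apply: eq_bigr => i _; rewrite !mxE -sqrrN opprB.
Qed.

(** From $(a-b)^2 \le 2a^2 + 2b^2$ in each coordinate: the squared distance is less than $2/4 + 2/4
    = 1$. *)
Lemma enorm_midpoint_lt x y z : enorm (z - x) < 2^-1 -> enorm (z - y) < 2^-1 ->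
  enorm (x - y) < 1.
Proof.
rewrite !enorm_lt// => zx zy.
apply: (@le_lt_trans _ _ (\sum_i (2 * (z - x) 0 i ^+ 2 + 2 * (z - y) 0 i ^+ 2))).
  apply: ler_sum => i _; rewrite !mxE.
  have := sqr_ge0 ((z 0 i - x 0 i) + (z 0 i - y 0 i)); lra.
by rewrite big_split/= -!mulr_sumr; lra.
Qed.

(** Each coordinate differs by at most $1/(d+1)$, whose square is no larger, so the sum of squares
    is at most $d/(d+1) < 1$. The factor 3 leaves room for a path of three steps of length [h]. *)
Lemma coord_enorm_lt1 x y (h : R) : h <= (3 * d.+1%:R)^-1 ->
  (forall i, `|x 0 i - y 0 i| <= 3 * h) -> enorm (x - y) < 1.
Proof.
move=> hd xy; have d0 : 0 < d.+1%:R :> R by [].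
have xyd i : `|x 0 i - y 0 i| <= d.+1%:R^-1.
  apply: (le_trans (xy i)); rewrite invfM in hd.
  by rewrite -(@ler_pM2l _ 3^-1)// mulrA mulVf// mul1r.
rewrite enorm_lt//; apply: (@le_lt_trans _ _ (\sum_(i < d) d.+1%:R^-1)).
  apply: ler_sum => i _; rewrite !mxE -real_normK ?num_real//.
  apply: (@le_trans _ _ (d.+1%:R^-1 ^+ 2)); first by rewrite lerXn2r// nnegrE.
  by rewrite expr2 ler_piMl ?invr_ge0// invf_le1// ler1n.
rewrite sumr_const card_ord expr1n -[X in X < _]mulr_natl ltr_pdivrMr// mul1r.
by rewrite ltr_nat.
Qed.

Lemma enorm_lt_ball x y (r : R) : 0 < r -> enorm (x - y) < r ->
  exists2 e : R, 0 < e & forall x' y', ball x e x' -> ball y e y' ->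
    enorm (x' - y') < r.
Proof.
move=> r0; rewrite enorm_lt// => xy.
pose F (w : 'rV[R]_d * 'rV[R]_d) : R := \sum_i (w.1 0 i - w.2 0 i) ^+ 2.
have FE w : F w = \sum_i (w.1 - w.2) 0 i ^+ 2.
  by apply: eq_bigr => i _; rewrite !mxE.
have cF : F w @[w --> (x, y)] --> F (x, y).
  apply: cvg_big => [|i _]; first exact: add_continuous.
  under eq_fun do rewrite expr2.
  have c1 : (fun w : 'rV[R]_d * 'rV[R]_d => w.1 0 i) @ (x, y) --> x 0 i.
    apply: (cvg_comp fst (fun v : 'rV[R]_d => v 0 i)); first exact: cvg_fst.
    exact: coord_continuous.
  have c2 : (fun w : 'rV[R]_d * 'rV[R]_d => w.2 0 i) @ (x, y) --> y 0 i.
    apply: (cvg_comp snd (fun v : 'rV[R]_d => v 0 i)); first exact: cvg_snd.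
    exact: coord_continuous.
  by rewrite expr2; apply: cvgM; apply: cvgB.
have : \forall w \near (x, y), F w < r ^+ 2.
  by apply: (cvgr_lt (F (x, y)) cF); rewrite FE.
move=> /nbhs_ballP[e /= e0 He]; exists e => // x' y' xx' yy'.
by rewrite enorm_lt// -(FE (x', y')); apply: He.
Qed.

Lemma open_enorm_ball x (r : R) : open [set z : 'rV[R]_d | enorm (z - x) < r].
Proof.
have [r0|r0] := ltP 0 r; last first.
  rewrite (_ : [set _ | _] = set0); first exact: open0.
  apply/seteqP; split => // z /= /lt_le_trans/(_ r0).
  by rewrite ltNge sqrtr_ge0.
rewrite openE => z /= /(enorm_lt_ball r0)[e e0 He].
apply/nbhs_ballP; exists e => //= z' zz'; apply: He => //.
exact: ballxx.
Qed.

Lemma neighborhoodE (r : R) (A : set 'rV[R]_d) :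
  neighborhood r A = \bigcup_(a in A) [set z | enorm (z - a) < r].
Proof.
apply/seteqP; split => [z /= | z [a Aa /= zar]].
  move=> /ereal_inf_lt[_ [a Aa <-]]; rewrite lte_fin => ?.
  by exists a.
apply: (@le_lt_trans _ _ (enorm (z - a))%:E); last by rewrite lte_fin.
by apply: ereal_inf_lbound; exists a.
Qed.

Lemma measurable_enorm_lt1 : measurable
  [set w : 'rV[R]_d * 'rV[R]_d | enorm (w.1 - w.2) < 1].
Proof.
pose F (w : 'rV[R]_d * 'rV[R]_d) : R := \sum_i (w.1 0 i - w.2 0 i) ^+ 2.
have FE (w : 'rV[R]_d * 'rV[R]_d) : \sum_i (w.1 - w.2) 0 i ^+ 2 = F w.
  by apply: eq_bigr => i _; rewrite !mxE.
have mF : measurable_fun setT F.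
  apply: measurable_sum => i.
  apply: measurable_funX; apply: measurable_funB.
  - exact: measurableT_comp (measurable_coord i) measurable_fst.
  - exact: measurableT_comp (measurable_coord i) measurable_snd.
rewrite (_ : [set _ | _] = setT `&` F @^-1` `]-oo, 1[); first exact: mF.
by rewrite setTI; apply/seteqP; split => w /=; rewrite in_itv/= enorm_lt// expr1n FE.
Qed.

End euclidean_norm.

(** An open set is the countable union of those grid balls of radius $1/(n+1)$, from the finite
    covers of the cubes, that it contains. *)
Lemma open_measurable_rV (R : realType) (d : nat) (A : set 'rV[R]_d) :
  open A -> measurable A.
Proof.
move=> oA; pose h n : R := n.+1%:R^-1.
have h0 n : 0 < h n by rewrite invr_gt0.
have /choice[K HK] : forall n, exists K : finType, exists c : K -> 'rV[R]_d,
  cube n%:R `<=` [set x | exists k, ball (c k) (h n) x].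
  by move=> n; exact: cube_cover.
pose c n := projT1 (cid (HK n)).
have Hc n : cube n%:R `<=` [set x | exists k, ball (c n k) (h n) x].
  by rewrite /c; case: cid.
pose B n k := if `[< ball (c n k) (h n) `<=` A >] then ball (c n k) (h n) else set0.
suff -> : A = \bigcup_n \bigcup_(k in [set: K n]) B n k.
  apply: bigcup_measurable => n _; apply: fin_bigcup_measurable.
    exact: finite_finset.
  move=> k _; rewrite /B; case: ifPn => _; [exact: measurable_ball_rV|exact: measurable0].
apply/seteqP; split => [x Ax|x [n _ [k _]]]; last first.
  by rewrite /B; case: asboolP => // AB /AB.
have /nbhs_ballP[e /= e0 xeA] : nbhs x A by exact: open_nbhs_nbhs.
pose M := \sum_i `|x 0 i|.
have M0 : 0 <= M by exact: sumr_ge0.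
(* Above [M], so that [x] lies in the cube; above [2 / e], so that twice the radius of the grid ball
   is at most [e]. *)
pose n := (Num.truncn (M + 2 / e)).+1.
have nM : M + 2 / e < n%:R by exact: truncnS_gt.
have xn : cube n%:R x.
  move=> i; apply: ltW; apply: (le_lt_trans _ nM).
  by rewrite /M (bigD1 i)//= -addrA lerDl addr_ge0 ?sumr_ge0// divr_ge0// ltW.
have [k xk] := Hc n x xn.
exists n => //; exists k => //; rewrite /B; case: asboolP => // -[].
move=> y yk; apply: xeA.
have hne : h n + h n <= e.
  have : 2 / e <= n.+1%:R.
    by rewrite -natr1 (le_trans (ltW (le_lt_trans _ nM)))// ?lerDr// lerDl.
  rewrite ler_pdivrMr// => H.
  by rewrite /h -mulr2n -[X in X <= _]mulr_natl ler_pdivrMr// mulrC.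
by apply: le_ball hne _ _; apply: ball_triangle yk; exact: ball_sym.
Qed.

(** * Controlled sets *)

Lemma setXSS (T1 T2 : Type) (A A' : set T1) (B B' : set T2) :
  A `<=` A' -> B `<=` B' -> A `*` B `<=` A' `*` B'.
Proof. by move=> AA' BB' z [/AA' ? /BB' ?]. Qed.

Section nonlocal_energy.
Context {R : realType} {d : nat}.
Variables (Omega : set 'rV[R]_d) (p : R).
Hypotheses (Omega_open : open Omega) (Omega_bounded : bounded_set Omega)
  (Omega_conn : connected (neighborhood 2^-1 Omega)) (p_ge1 : 1 <= p).
(* In the degenerate case where this fails, [Omega] is null: this makes the
   computation of the measure of a box unnecessary. *)
Hypothesis ball_gt0 : forall (x : 'rV[R]_d) (e : R),
  0 < e -> (0 < @lebesgue_Rd R d (ball x e))%E.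

Local Notation mu := (@lebesgue_Rd R d).
Local Notation strip := [set w : 'rV[R]_d * 'rV[R]_d | enorm (w.1 - w.2) < 1].

Definition energy (f : 'rV[R]_d -> R) : \bar R :=
  (\int[mu \x mu]_(z in Omega `*` Omega)
     (`|f z.1 - f z.2| `^ p * \1_strip z)%:E)%E.

Local Notation ctl := (controlled mu p energy).

Lemma measurable_Omega : measurable Omega.
Proof. exact: open_measurable_rV. Qed.

Lemma Omega_finite : (mu Omega < +oo)%E.
Proof.
have [M OM] := bounded_cube Omega_bounded.
exact: le_lt_trans (le_outer_measure lebesgue_outer _ _ OM) (cube_finite M).
Qed.

Lemma sub_Omega_finite A : A `<=` Omega -> (mu A < +oo)%E.
Proof.
by move=> AO; exact: le_lt_trans (le_outer_measure lebesgue_outer _ _ AO) Omega_finite.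
Qed.

(** The indicator is 1 on [S], so monotonicity of the integral gives the constant 1. *)
Lemma controlled_strip (S : set ('rV[R]_d * 'rV[R]_d)) : measurable S ->
  S `<=` Omega `*` Omega -> S `<=` strip -> ctl S.
Proof.
move=> mS SO Sstrip; exists 1 => // f mf; rewrite mul1e.
have mO2 : measurable (Omega `*` Omega).
  by apply: measurableX; exact: measurable_Omega.
pose h (z : 'rV[R]_d * 'rV[R]_d) : R := `|f z.1 - f z.2| `^ p * \1_strip z.
have mh : measurable_fun setT (EFin \o h).
  apply/measurable_EFinP; apply: measurable_funM.
    by have /measurable_EFinP := @measurable_dist_powR _ _ _ p f mf.
  exact: measurable_indic measurable_enorm_lt1.
have -> : (\int[mu \x mu]_(z in S) dist_powR p f z =
    \int[mu \x mu]_(z in S) (EFin \o h) z)%E.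
  apply: eq_integral => z; rewrite inE => Sz.
  by rewrite /dist_powR /h /= indicE mem_set ?mulr1//; exact: Sstrip.
apply: (ge0_subset_integral (mu \x mu)%E mS mO2 (measurable_funTS mh) _ SO).
by move=> z _; rewrite lee_fin mulr_ge0 ?powR_ge0.
Qed.

(** Both orders of the product are recorded, which makes the relation symmetric by its form; the
    common radius can be shrunk when two links are chained. *)
Definition linked (x y : 'rV[R]_d) := exists e : R,
  [/\ 0 < e, ball x e `<=` Omega, ball y e `<=` Omega,
    ctl (ball x e `*` ball y e) & ctl (ball y e `*` ball x e)].

Lemma controlled_ballS (x y : 'rV[R]_d) (e e' : R) : e <= e' ->
  ctl (ball x e' `*` ball y e') -> ctl (ball x e `*` ball y e).
Proof.
move=> ee'; apply: controlledS.
- by apply: measurableX; exact: measurable_ball_rV.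
- by apply: measurableX; exact: measurable_ball_rV.
- by apply: setXSS; exact: le_ball.
Qed.

Lemma controlled_ball_trans (x y z : 'rV[R]_d) (e : R) : 0 < e ->
  ball x e `<=` Omega -> ball y e `<=` Omega -> ball z e `<=` Omega ->
  ctl (ball x e `*` ball y e) -> ctl (ball y e `*` ball z e) ->
  ctl (ball x e `*` ball z e).
Proof.
move=> e0 xO yO zO; have mb (u : 'rV[R]_d) := measurable_ball_rV u e.
apply: (controlled_trans p_ge1 (mb x) (mb y) (mb z)).
- exact: sub_Omega_finite.
- by rewrite ball_gt0//= sub_Omega_finite.
- exact: sub_Omega_finite.
Qed.

Lemma linked_trans y x z : linked x y -> linked y z -> linked x z.
Proof.
move=> [e [e0 xO yO xy yx]] [e' [e'0 yO' zO yz zy]].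
pose r := Num.min e e'.
have re : r <= e by rewrite ge_min lexx.
have re' : r <= e' by rewrite ge_min lexx orbT.
have r0 : 0 < r by rewrite lt_min e0.
have rx : ball x r `<=` Omega := subset_trans (le_ball re) xO.
have ry : ball y r `<=` Omega := subset_trans (le_ball re) yO.
have rz : ball z r `<=` Omega := subset_trans (le_ball re') zO.
exists r; split => //.
- exact: (controlled_ball_trans r0 rx ry rz
    (controlled_ballS re xy) (controlled_ballS re' yz)).
- exact: (controlled_ball_trans r0 rz ry rx
    (controlled_ballS re' zy) (controlled_ballS re yx)).
Qed.

Lemma ball_sub_Omega x : Omega x -> exists2 e : R, 0 < e & ball x e `<=` Omega.
Proof.
move=> Ox; have /nbhs_ballP[e e0 xe] : nbhs x Omega by exact: open_nbhs_nbhs.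
by exists e.
Qed.

Lemma linked_enorm_lt1 x y : Omega x -> Omega y -> enorm (x - y) < 1 -> linked x y.
Proof.
move=> Ox Oy xy; have [e e0 He] := enorm_lt_ball ltr01 xy.
have [ex ex0 xO] := ball_sub_Omega Ox; have [ey ey0 yO] := ball_sub_Omega Oy.
pose r := Num.min e (Num.min ex ey).
have re : r <= e by rewrite ge_min lexx.
have rx : r <= ex by rewrite !ge_min lexx orbT.
have ry : r <= ey by rewrite !ge_min lexx !orbT.
have r0 : 0 < r by rewrite !lt_min e0 ex0.
have xr : ball x r `<=` Omega := subset_trans (le_ball rx) xO.
have yr : ball y r `<=` Omega := subset_trans (le_ball ry) yO.
exists r; split => //; apply: controlled_strip.
- by apply: measurableX; exact: measurable_ball_rV.
- exact: setXSS.
- by move=> [x' y'] [/= /(le_ball re) ? /(le_ball re) ?]; exact: He.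
- by apply: measurableX; exact: measurable_ball_rV.
- exact: setXSS.
- by move=> [y' x'] [/= /(le_ball re) ? /(le_ball re) ?]; rewrite enormC; exact: He.
Qed.

(** [S] and [T] are the unions of the balls of radius $1/2$ around the points of [Omega] that are
    linked to [x] and around those that are not. They split the connected neighborhood into two
    disjoint open sets. *)
Lemma linked_Omega x y : Omega x -> Omega y -> linked x y.
Proof.
move=> Ox Oy.
pose S := \bigcup_(a in Omega `&` linked x) [set z | enorm (z - a) < 2^-1].
pose T := \bigcup_(a in Omega `\` linked x) [set z | enorm (z - a) < 2^-1].
have oS : open S by apply: bigcup_open => a _; exact: open_enorm_ball.
have oT : open T by apply: bigcup_open => a _; exact: open_enorm_ball.
(* A common point would put a linked [a] and an unlinked [b] at distance less than 1, which links
   [b] as well. *)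
have ST z : S z -> T z -> False.
  move=> [a [Oa xa] za] [b [Ob xb] zb]; apply: xb.
  apply: (linked_trans xa); apply: linked_enorm_lt1 => //.
  exact: enorm_midpoint_lt za zb.
have NE : neighborhood 2^-1 Omega = S `|` T.
  rewrite neighborhoodE; apply/seteqP; split => [z [a Oa za]|z].
    by have [xa|xa] := pselect (linked x a); [left|right]; exists a.
  by move=> [|] [a [Oa _] za]; exists a.
have self (z : 'rV[R]_d) : enorm (z - z) < 2^-1.
  by rewrite enorm_lt// subrr big1 => [|i _]; rewrite ?exprn_gt0// mxE expr0n.
have half_lt1 : 2^-1 < 1 :> R by rewrite invf_lt1// ltr1n.
have SN : S = neighborhood 2^-1 Omega.
  (* [S] contains [x], is open, and is relatively closed as the complement of [T]. *)
  apply: Omega_conn.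
  - exists x; exists x; last exact: self.
    split => //.
    by apply: linked_enorm_lt1 => //; rewrite (lt_trans (self x))// invf_lt1// ltr1n.
  - exists S => //; rewrite NE; apply/seteqP; split => z; last by case.
    by move=> Sz; split => //; left.
  - exists (~` T); first exact: open_closedC.
    rewrite NE; apply/seteqP; split => z; first by move=> Sz; split; [left|move=> /(ST z Sz)].
    by move=> [[|]].
have : S y by rewrite SN neighborhoodE; exists y => //=; exact: self.
move=> [a [Oa xa] ya]; apply: (linked_trans xa).
by apply: linked_enorm_lt1 => //; rewrite enormC (lt_trans ya).
Qed.

(** Each pair of nonempty cells is joined by the chain [U k], [ball x e], [ball y e], [U l], with
    [x] and [y] taken in the cells. The outer links lie in the strip because the cells are small;
    the middle one is [linked_Omega]. *)
Lemma controlled_Omega : ctl (Omega `*` Omega).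
Proof.
pose h : R := (3 * d.+1%:R)^-1.
have h0 : 0 < h by rewrite invr_gt0 mulr_gt0.
have [M OM] := bounded_cube Omega_bounded.
have [K [c Kc]] := @cube_cover R d M h h0.
pose U k := Omega `&` ball (c k) h.
have mU k : measurable (U k).
  by apply: measurableI; [exact: measurable_Omega|exact: measurable_ball_rV].
have UO k : U k `<=` Omega by exact: subIsetl.
(* The path from [y] through [c k] and [x] to [z] has three steps, each less than [h] in every
   coordinate. *)
have near_cell k x e y z : U k x -> e <= h -> U k y -> ball x e z -> enorm (y - z) < 1.
  move=> [_ xk] eh [_ yk] /(le_ball eh) xz.
  apply: (@coord_enorm_lt1 _ _ _ _ h) => // i; move: xk yk xz.
  rewrite !ball_rVE// => /(_ i) xk /(_ i) yk /(_ i) xz.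
  have -> : y 0 i - z 0 i = - (c k 0 i - y 0 i) + (c k 0 i - x 0 i) + (x 0 i - z 0 i) by ring.
  rewrite (le_trans (ler_normD _ _))//.
  have := ler_normD (- (c k 0 i - y 0 i)) (c k 0 i - x 0 i); rewrite normrN.
  by lra.
have cU k l : ctl (U k `*` U l).
  have [[x Ux]|/set0P/negP/negPn/eqP ->] := pselect (U k !=set0); last first.
    by rewrite set0X; exact: controlled0.
  have [[y Uy]|/set0P/negP/negPn/eqP ->] := pselect (U l !=set0); last first.
    by rewrite setX0; exact: controlled0.
  have [e' [e'0 xO' yO' xy' _]] := linked_Omega (UO _ _ Ux) (UO _ _ Uy).
  pose e := Num.min e' h.
  have ee' : e <= e' by rewrite ge_min lexx.
  have eh : e <= h by rewrite ge_min lexx orbT.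
  have e0 : 0 < e by rewrite lt_min e'0.
  have xO : ball x e `<=` Omega := subset_trans (le_ball ee') xO'.
  have yO : ball y e `<=` Omega := subset_trans (le_ball ee') yO'.
  have xy := controlled_ballS ee' xy'.
  have Ux_ : ctl (U k `*` ball x e).
    apply: controlled_strip.
    - by apply: measurableX => //; exact: measurable_ball_rV.
    - by apply: setXSS => //; exact: UO.
    - by move=> [u v] [/= Uu xv]; exact: near_cell Ux eh Uu xv.
  have Uy_ : ctl (ball y e `*` U l).
    apply: controlled_strip.
    - by apply: measurableX => //; exact: measurable_ball_rV.
    - by apply: setXSS => //; exact: UO.
    - by move=> [v u] [/= yv Uu]; rewrite enormC; exact: near_cell Uy eh Uu yv.
  have fin A : A `<=` Omega -> (mu A < +oo)%E by exact: sub_Omega_finite.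
  have pos z : ball z e `<=` Omega -> (0 < mu (ball z e) < +oo)%E.
    by move=> zO; rewrite ball_gt0//= fin.
  have mb (z : 'rV[R]_d) : measurable (ball z e) by exact: measurable_ball_rV.
  apply: (controlled_trans p_ge1 (mU k) (mb x) (mU l)
    (fin _ (@UO k)) (pos x xO) (fin _ (@UO l)) Ux_).
  exact: (controlled_trans p_ge1 (mb x) (mb y) (mU l)
    (fin _ xO) (pos y yO) (fin _ (@UO l)) xy Uy_).
apply: (@controlledS _ _ _ mu p energy _
  (\big[setU/set0]_(kl : K * K) (U kl.1 `*` U kl.2))).
- by apply: measurableX; exact: measurable_Omega.
- by apply: bigsetU_measurable => kl _; exact: measurableX.
- move=> [x y] [/= Ox Oy]; have [k kx] := Kc _ (OM _ Ox); have [l ly] := Kc _ (OM _ Oy).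
  by rewrite -bigcup_seq; exists (k, l); [rewrite /= mem_index_enum|].
- apply: controlled_bigsetU => // kl; exact: measurableX.
Qed.

End nonlocal_energy.

(** * From controlled pairs to the mean-zero inequality *)

Theorem corollary2 (R : realType) (d : nat) (Omega : set 'rV[R]_d) (p : R)
    (Omega_open : open Omega) (Omega_bounded : bounded_set Omega)
    (Omega_conn : connected (neighborhood 2^-1 Omega)) (p_ge1 : 1 <= p) :
  exists C : R, forall f : 'rV[R]_d -> R,
    measurable_fun Omega f ->
    lebesgue_Rd.-integrable Omega (EFin \o f) ->
    (\int[lebesgue_Rd]_(x in Omega) (f x)%:E = 0)%E ->
    (\int[lebesgue_Rd]_(x in Omega) (`|f x| `^ p)%:E <=
      C%:E * \int[lebesgue_Rd \x lebesgue_Rd]_(z in Omega `*` Omega)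
        (`|f z.1 - f z.2| `^ p *
         \1_[set w : 'rV[R]_d * 'rV[R]_d | enorm (w.1 - w.2) < 1] z)%:E)%E.
Proof.
have mOm : measurable Omega by exact: open_measurable_rV.
(* For null [Omega] the left-hand side vanishes. Otherwise a null ball would make the bounded set
   [Omega] null, so all balls have positive measure. *)
have [Om0|Om0] := eqVneq (@lebesgue_Rd R d Omega) 0%E.
  exists 0 => f mf _ _; rewrite mul0e (null_set_integral mOm _ Om0)//.
  apply/measurable_EFinP; apply: (measurableT_comp (measurable_powR p)).
  exact: measurableT_comp.
have ball_gt0 (x : 'rV[R]_d) (e : R) : 0 < e -> (0 < @lebesgue_Rd R d (ball x e))%E.
  move=> e0; rewrite lt0e measure_ge0 andbT; apply: contra Om0 => /eqP b0.
  by apply/eqP; apply: (null_nbhs Omega_bounded _ b0); exact: nbhsx_ballx.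
have Omfin := Omega_finite Omega_bounded.
have [m m0 Om] : exists2 m : R, 0 < m & @lebesgue_Rd R d Omega = m%:E.
  exists (fine (@lebesgue_Rd R d Omega)).
    by rewrite fine_gt0// Omfin lt0e Om0 measure_ge0.
  by rewrite fineK// ge0_fin_numE.
have [C C0 HC] := controlled_Omega Omega_open Omega_bounded Omega_conn p_ge1 ball_gt0.
(* Averaging over [Omega] gives $m^{-1}$, the absorption step $2^p$, and [controlled_Omega] gives
   [C]. *)
exists (m^-1 * (2 `^ p * C)) => f mf intf f0.
(* The earlier lemmas ask for measurability on the whole space; [F] agrees with [f] on [Omega], so
   no integral changes. *)
pose F := f \_ Omega.
have FE x : Omega x -> F x = f x by move=> Ox; rewrite /F patchE mem_set.
have mF : measurable_fun setT F by apply/(measurable_restrictT _ mOm).1.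
have intF : lebesgue_Rd.-integrable Omega (EFin \o F).
  apply: eq_integrable intf => // x; rewrite inE => Ox.
  by rewrite /= FE.
have F0 : (\int[lebesgue_Rd]_(x in Omega) (F x)%:E = 0)%E.
  by rewrite -[RHS]f0; apply: eq_integral => x; rewrite inE => /FE ->.
have H := integral_powR_le_dist p_ge1 mOm Om m0 mF intF F0.
have -> : (\int[lebesgue_Rd]_(x in Omega) (`|f x| `^ p)%:E =
           \int[lebesgue_Rd]_(x in Omega) (`|F x| `^ p)%:E)%E.
  by apply: eq_integral => x; rewrite inE => /FE ->.
rewrite EFinM -muleA lee_pdivlMl//; apply: (le_trans H).
rewrite EFinM -muleA lee_pmul2l// ?lte_fin ?powR_gt0//.
apply: (le_trans (HC F mF)); apply: lee_wpmul2l; first by rewrite lee_fin.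
rewrite le_eqVlt; apply/orP; left; apply/eqP.
by apply: eq_integral => -[x y]; rewrite inE => -[/= /FE -> /FE ->].
Qed.
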